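(* An Abelian group $G$ is fully generalized Bassian if and only if $G$ is a Bassian group.
   Context: All groups are Abelian, written additively. An injection between groups means an injective homomorphism. A group $G$ is Bassian if, for every subgroup $N \leq G$, the existence of an injection $G \to G/N$ implies $N = \{0\}$. A subgroup $F$ of $G$ is fully invariant if $\phi(F) \subseteq F$ for every endomorphism $\phi$ of $G$. A group $G$ is fully generalized Bassian if, for every subgroup $N \leq G$, the existence of an injection $G \to G/N$ implies that $N$ is a fully invariant direct summand of $G$. *)

(* Defs.v *)
From HB Require Import structures.
From mathcomp Require Import all_boot all_algebra.
From mathcomp Require Import boolp.

Set Implicit Arguments.
Unset Strict Implicit.
Unset Printing Implicit Defensive.

Import GRing.Theory.
Local Open Scope ring_scope.

(* An Abelian group is a [zmodType] and a subgroup a [zmodClosed] predicate.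
   The latter is boolean-valued; under the classical axioms of [boolp] this
   loses no subgroup, as the following lemma shows. *)
Lemma zmodClosed_of_Prop (G : zmodType) (P : G -> Prop) :
  P 0 -> (forall x y, P x -> P y -> P (x - y)) ->
  exists N : zmodClosed G, forall x, x \in N <-> P x.
Proof.
move=> P0 PB; pose p : {pred G} := fun x => `[< P x >].
have cp : zmod_closed p.
  split; first exact/asboolP.
  by move=> x y /asboolP Px /asboolP Py; apply/asboolP/PB.
pose c := GRing.isZmodClosed.Build G p cp.
pose N : zmodClosed G := HB.pack p c.
by exists N => x; split=> /asboolP.
Qed.

Definition fully_invariant (G : zmodType) (F : zmodClosed G) : Prop :=
  forall phi : {additive G -> G}, {in F, forall x, phi x \in F}.

Definition direct_summand (G : zmodType) (N : zmodClosed G) : Prop :=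
  exists K : zmodClosed G,
    (forall x, x \in N -> x \in K -> x = 0) /\
    (forall x, exists u v, [/\ u \in N, v \in K & x = u + v]).

Definition has_injection (G H : zmodType) : Prop :=
  exists f : {additive G -> H}, injective f.

(* [Quotient.quot N] is the quotient group G/N; despite its location in the
   ideal-quotient library it is built for any subgroup of a [zmodType]. *)
Definition bassian (G : zmodType) : Prop :=
  forall N : zmodClosed G,
    has_injection G (Quotient.quot N) -> N =i pred1 0.

Definition fully_generalized_bassian (G : zmodType) : Prop :=
  forall N : zmodClosed G,
    has_injection G (Quotient.quot N) ->
    fully_invariant N /\ direct_summand N.

(* Main.v *)
Require Import Defs.
From mathcomp Require Import all_boot all_algebra.
From HB Require Import structures.
From mathcomp Require Import generic_quotient boolp.

(** If [G] embeds in [G/N] with [N] a fully invariant summand, [G = N + K], then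
    [G/N] is isomorphic to [K], so the embedding becomes an injective
    endomorphism [phi] of [G] with image in [K].  Full invariance gives
    [phi(N)] inside the intersection of [N] and [K], which is [0]; hence
    [N = 0]. *)

Import GRing.Theory.
Local Open Scope ring_scope.

Lemma additive_of_fun (G H : zmodType) (p : G -> H) :
  {morph p : x y / x - y} -> exists phi : {additive G -> H}, phi =1 p.
Proof.
move=> pB; pose c := GRing.isZmodMorphism.Build G H p pB.
by pose phi : {additive G -> H} := HB.pack p c; exists phi.
Qed.

(** As [N] and [K] are complementary, each coset of [N] meets [K] in exactly one point; [s] picks
    that point. *)
Lemma quot_section_to_summand (G : zmodType) (N : zmodClosed G) :
  direct_summand N ->
  exists (K : zmodClosed G) (s : {additive Quotient.quot N -> G}),
    [/\ forall x, x \in N -> x \in K -> x = 0,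
        forall q, s q \in K & injective s].
Proof.
move=> [K [NK0 NK]].
have /choice [s sP] (q : Quotient.quot N) :
    exists v, v \in K /\ \pi_(Quotient.quot N)%qT v = q.
  (* The [K]-component of a representative differs from it by an element of [N], so it lies in the
     same coset. *)
  have [u [v [uN vK repr_q]]] := NK (repr q).
  exists v; split=> //; rewrite -[q in RHS]reprK; apply/eqP.
  by rewrite eq_sym -Quotient.idealrBE repr_q addrK.
have sB : {morph s : x y / x - y}.
  (* Both sides project to [x - y], so their difference lies in [N] as well as in [K]. *)
  move=> x y; apply: subr0_eq; apply: NK0; last first.
    by rewrite !rpredB ?(sP _).1.
  rewrite Quotient.idealrBE; apply/eqP.
  by rewrite [LHS](sP _).2 raddfB; congr (_ - _); apply/esym/(sP _).2.
have [phi phiE] := additive_of_fun _ _ s sB.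
exists K, phi; split=> // [q|x y]; first by rewrite phiE; case: (sP q).
by rewrite !phiE => /(congr1 (\pi_(Quotient.quot N)%qT)); rewrite !(sP _).2.
Qed.

Theorem theorem2p6 (G : zmodType) : fully_generalized_bassian G <-> bassian G.
Proof.
split=> [fgbG N injG | bG N injG].
  have [Ninv Nsum] := fgbG N injG; have [f f_inj] := injG.
  have [K [s [NK0 sK s_inj]]] := quot_section_to_summand _ _ Nsum.
  move=> x; rewrite !inE; apply/idP/eqP => [xN | ->]; last exact: rpred0.
  apply/f_inj/s_inj; rewrite !raddf0; apply: NK0; last exact: sK.
  exact: Ninv (s \o f) x xN.
have N0 := bG N injG; split=> [phi x|].
  by rewrite !N0 !inE => /eqP ->; rewrite raddf0.
(* The zero subgroup has the whole group as a complement. *)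
have [//|//|K KT] := @zmodClosed_of_Prop G (fun=> True).
exists K; split=> [x|x]; first by rewrite N0 inE => /eqP.
by exists 0, x; rewrite add0r rpred0; split=> //; apply/KT.
Qed.
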